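(* Let $0\to\mathfrak{a}\xrightarrow{i}\mathfrak{h}\xrightarrow{p}\mathfrak{g}\to0$ be a central extension of Leibniz algebras and let $(\phi_\mathfrak{g},\phi_\mathfrak{a})\in\mathrm{Der}(\mathfrak{g})\times\mathrm{Der}(\mathfrak{a})$. For a section $s:\mathfrak{g}\to\mathfrak{h}$ of $p$, put $\psi(x,y)=[s(x),s(y)]-s[x,y]\in\mathfrak{a}$ (identifying $\mathfrak{a}$ with $i(\mathfrak{a})$) and $$\mathrm{Ob}^\mathfrak{h}_{(\phi_\mathfrak{g},\phi_\mathfrak{a})}(x,y)=\phi_\mathfrak{a}(\psi(x,y))-\psi(\phi_\mathfrak{g}(x),y)-\psi(x,\phi_\mathfrak{g}(y)),\qquad x,y\in\mathfrak{g}.$$ Then the map $\mathrm{Ob}^\mathfrak{h}_{(\phi_\mathfrak{g},\phi_\mathfrak{a})}:\mathfrak{g}^{\otimes2}\to\mathfrak{a}$ is a 2-cocycle in the cohomology of the Leibniz algebra $\mathfrak{g}$ with coefficients in the trivial representation $\mathfrak{a}$. Moreover, the cohomology class $[\mathrm{Ob}^\mathfrak{h}_{(\phi_\mathfrak{g},\phi_\mathfrak{a})}]\in H^2(\mathfrak{g},\mathfrak{a})$ does not depend on the choice of the section.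
   Context: All vector spaces and linear maps are over a field $\mathbb{K}$ of characteristic zero. A (right) Leibniz algebra is a vector space with a bilinear bracket satisfying $[[x,y],z]=[[x,z],y]+[x,[y,z]]$; $\mathrm{Der}(\mathfrak{g})$ is the set of linear maps $\phi:\mathfrak{g}\to\mathfrak{g}$ with $\phi[x,y]=[\phi(x),y]+[x,\phi(y)]$. A central extension $0\to\mathfrak{a}\xrightarrow{i}\mathfrak{h}\xrightarrow{p}\mathfrak{g}\to0$ is an exact sequence of Leibniz algebras with $\mathfrak{a}$ abelian (zero bracket) and $[i(a),h]=0=[h,i(a)]$ for all $a\in\mathfrak{a},h\in\mathfrak{h}$. A section of $p$ is a linear map $s:\mathfrak{g}\to\mathfrak{h}$ with $p\circ s=\mathrm{id}_\mathfrak{g}$. $H^n(\mathfrak{g},\mathfrak{a})$, the Leibniz cohomology with coefficients in the trivial representation (zero actions), is the $n$-th cohomology of the complex $\mathrm{Hom}(\mathfrak{g}^{\otimes n},\mathfrak{a})$ with differential $$(\delta_Lf)(x_1,\ldots,x_{n+1})=\sum_{i<j}(-1)^{j+1}f(x_1,\ldots,x_{i-1},[x_i,x_j],x_{i+1},\ldots,\widehat{x_j},\ldots,x_{n+1}).$$ *)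

(* Defs.v *)
From HB Require Import structures.
From mathcomp Require Import all_boot all_algebra.
From mathcomp Require Import boolp classical_sets functions.

Set Implicit Arguments.
Unset Strict Implicit.
Unset Printing Implicit Defensive.

Import GRing.Theory.
Local Open Scope ring_scope.

HB.mixin Record Lmodule_isLeibniz (K : fieldType) g of GRing.Lmodule K g := {
  bracket : g -> g -> g;
  bracket_linearl : forall y, linear (fun x => bracket x y);
  bracket_linearr : forall x, linear (bracket x);
  bracket_leibniz : forall x y z,
    bracket (bracket x y) z = bracket (bracket x z) y + bracket x (bracket y z)
}.

#[short(type="leibnizType")]
HB.structure Definition Leibniz (K : fieldType) :=
  {g of Lmodule_isLeibniz K g & GRing.Lmodule K g}.

Definition derivation (K : fieldType) (g : leibnizType K)
    (phi : {linear g -> g}) : Prop :=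
  forall x y, phi (bracket x y) = bracket (phi x) y + bracket x (phi y).

Definition leibniz_morphism (K : fieldType) (g1 g2 : leibnizType K)
    (f : {linear g1 -> g2}) : Prop :=
  forall x y, f (bracket x y) = bracket (f x) (f y).

Record central_extension (K : fieldType) (a h g : leibnizType K)
    (i : {linear a -> h}) (p : {linear h -> g}) : Prop := CentralExtension {
  ext_i_morph : leibniz_morphism i;
  ext_p_morph : leibniz_morphism p;
  ext_inj : injective i;
  ext_exact : forall x, p x = 0 <-> exists u, i u = x;
  ext_surj : forall y, exists x, p x = y;
  ext_abelian : forall u v : a, bracket u v = 0;
  ext_central : forall u x, bracket (i u) x = 0 /\ bracket x (i u) = 0
}.

Definition is_section (K : fieldType) (h g : leibnizType K)
    (p : {linear h -> g}) (s : {linear g -> h}) : Prop :=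
  forall x, p (s x) = x.

Section Cohomology.
Variables (K : fieldType) (g : leibnizType K) (a : lmodType K).

(* Hom(g^{\otimes n}, a) is rendered as the n-linear maps from g^n to a. *)
Definition multilinear n (f : {ffun 'I_n -> g} -> a) : Prop :=
  forall (k : 'I_n) (x : {ffun 'I_n -> g}),
    linear (fun u => f [ffun l => if l == k then u else x l]).

(* The arguments x_1, .., [x_i, x_j] (in place of x_i), .., x_n with x_j
   omitted: lift j enumerates the indices other than j in increasing order. *)
Definition contract n (x : {ffun 'I_n.+1 -> g}) (i j : 'I_n.+1) :
    {ffun 'I_n -> g} :=
  [ffun k => if lift j k == i then bracket (x i) (x j) else x (lift j k)].

(* The ordinal j is 0-based: the usual 1-based sign (-1)^{j+1} becomes
   (-1)^{j+2}. *)
Definition delta n (f : {ffun 'I_n -> g} -> a) : {ffun 'I_n.+1 -> g} -> a :=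
  fun x => \sum_(i < n.+1) \sum_(j < n.+1 | (i < j)%N)
             (-1) ^+ j.+2 *: f (contract x i j).

Definition cocycle n : {pred {ffun 'I_n -> g} -> a} :=
  fun f => `[< multilinear f /\ delta f = 0 >].

Definition coboundary n : ({ffun 'I_n -> g} -> a) -> Prop :=
  match n with
  | 0 => fun f => f = 0
  | m.+1 => fun f => exists2 e : {ffun 'I_m -> g} -> a,
                       multilinear e & f = delta e
  end.

Lemma multilinear0 n : multilinear (0 : {ffun 'I_n -> g} -> a).
Proof. by move=> k x c u v /=; rewrite /GRing.zero/= scaler0 addr0. Qed.

Lemma multilinearB n (f e : {ffun 'I_n -> g} -> a) :
  multilinear f -> multilinear e -> multilinear (f - e).
Proof.
move=> lf le k x c u v /=; move: (lf k x c u v) (le k x c u v) => /= Ef Ee.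
by rewrite !fctE Ef Ee scalerBr opprD addrACA.
Qed.

Lemma delta0 n : delta (0 : {ffun 'I_n -> g} -> a) = 0.
Proof.
by apply/funext => x; rewrite /delta big1 // => i _; rewrite big1 // => j _;
   rewrite scaler0.
Qed.

Lemma deltaB n (f e : {ffun 'I_n -> g} -> a) :
  delta (f - e) = delta f - delta e.
Proof.
apply/funext => x; rewrite !fctE /delta -sumrB; apply: eq_bigr => i _.
by rewrite -sumrB; apply: eq_bigr => j _; rewrite scalerBr.
Qed.

Lemma cocycle_zmod_closed n : zmod_closed (@cocycle n).
Proof.
split=> [|f e /asboolP[lf df] /asboolP[le de]]; apply/asboolP.
  by split; [exact: multilinear0 | exact: delta0].
by split; [exact: multilinearB | rewrite deltaB df de subr0].
Qed.

HB.instance Definition _ n :=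
  GRing.isZmodClosed.Build ({ffun 'I_n -> g} -> a) (@cocycle n)
    (cocycle_zmod_closed n).

Record Z n := Cocycle {
  cochain_of_cocycle :> {ffun 'I_n -> g} -> a;
  _ : cochain_of_cocycle \in @cocycle n
}.

HB.instance Definition _ n := [isSub for @cochain_of_cocycle n].
HB.instance Definition _ n := [Choice of Z n by <:].
HB.instance Definition _ n := [SubChoice_isSubZmodule of Z n by <:].

Definition B n : {pred Z n} := fun f => `[< coboundary (f : _ -> a) >].

Lemma B_zmod_closed n : zmod_closed (@B n).
Proof.
split=> [|f e /asboolP fB /asboolP eB]; apply/asboolP.
  case: n => [|n] //=; exists 0; first exact: multilinear0.
  by rewrite delta0.
case: n f e fB eB => [|n] f e /= => [-> ->|[f' lf ->] [e' le ->]].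
  by rewrite subr0.
exists (f' - e'); first exact: multilinearB.
by rewrite deltaB.
Qed.

HB.instance Definition _ n :=
  GRing.isZmodClosed.Build (Z n) (@B n) (B_zmod_closed n).

(* H^n(g, a) for the trivial representation a, as the quotient of Z^n by the
   coboundaries in Z^n; the bracket of a Leibniz algebra a is not used. *)
Definition H n : zmodType := Quotient.quot (@B n).

Definition cohomology_class n (f : {ffun 'I_n -> g} -> a)
    (fZ : f \in @cocycle n) : H n :=
  \pi_(H n)%qT (Cocycle fZ).

End Cohomology.

Arguments cocycle {K} g a n.
Arguments H {K} g a n.

Section Obstruction.
Variables (K : fieldType) (a h g : leibnizType K).
Variables (i : {linear a -> h}) (p : {linear h -> g}).

(* psi is a-valued: the unique preimage under i of [s x, s y] - s [x, y];
   see psiE. *)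
Definition psi (s : {linear g -> h}) (x y : g) : a :=
  xget 0 [set u | i u = bracket (s x) (s y) - s (bracket x y)]%classic.

Lemma psiE (s : {linear g -> h}) (x y : g) :
  central_extension i p -> is_section p s ->
  i (psi s x y) = bracket (s x) (s y) - s (bracket x y).
Proof.
move=> E ps; have [u iu] : exists u, i u = bracket (s x) (s y) - s (bracket x y).
  by apply/(ext_exact E); rewrite linearB /= (ext_p_morph E) !ps subrr.
by rewrite /psi; case: xgetP => [v _ //|/(_ u)].
Qed.

Definition obstruction (phig : {linear g -> g}) (phia : {linear a -> a})
    (s : {linear g -> h}) (x : {ffun 'I_2 -> g}) : a :=
  let x1 := x ord0 in let x2 := x ord_max in
  phia (psi s x1 x2) - psi s (phig x1) x2 - psi s x1 (phig x2).

End Obstruction.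

(* Main.v *)
Require Import Defs.
From mathcomp Require Import all_boot all_algebra.
From HB Require Import structures.
From mathcomp Require Import boolp functions.
Import GRing.Theory.
Local Open Scope ring_scope.

(** Fix a section [s] of the extension and let [psi] be its defect, with values
    in [a].  Since [i] is injective with central image, brackets in [h] only see
    the components [s x], so the Leibniz identity of [h] applied to [s x],
    [s y], [s z] says exactly that [psi] is a 2-cocycle ([psi_leibniz2]).  The
    obstruction is obtained from [psi] by the natural action of the pair
    [(phig, phia)] on bilinear maps; because [phig] is a derivation this action
    preserves the cocycle identity ([twist_leibniz2]), so the obstruction is a
    cocycle.

    Two sections differ by [i \o u] for a linear map [u : g -> a], because
    their difference is killed by [p].  By centrality [s x] and [s' x] have
    the same brackets, so the two defects differ only through the term
    [s (bracket x y)], that is by [- u (bracket x y)] ([psi_section]), which is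
    the coboundary of [u].  Applying the action of [(phig, phia)] and using once
    more that [phig] is a derivation, the two obstructions differ by the
    coboundary of the commutator-like map [phia \o u - u \o phig]. *)

Section Bracket.
Context {K : fieldType} {g : leibnizType K}.
Implicit Types x y z : g.

Lemma bracketDl x y z : bracket (x + y) z = bracket x z + bracket y z.
Proof. by have /= := bracket_linearl z 1 x y; rewrite !scale1r. Qed.

Lemma bracketDr x y z : bracket x (y + z) = bracket x y + bracket x z.
Proof. by have /= := bracket_linearr x 1 y z; rewrite !scale1r. Qed.

End Bracket.

(** * Cochains of low degree with trivial coefficients *)

Section LowDegree.
Context {K : fieldType} {g : leibnizType K} {a : lmodType K}.

Definition bilinear2 (w : g -> g -> a) : Prop :=
  (forall y, linear (w^~ y)) /\ (forall x, linear (w x)).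

(** The 2-cocycle condition in expanded form; a bilinear [w] satisfies it iff it
    is the twisting term of a Leibniz bracket on the direct sum of [g] and [a],
    with [a] central. *)
Definition leibniz2 (w : g -> g -> a) : Prop :=
  forall x y z, w (bracket x y) z = w (bracket x z) y + w x (bracket y z).

(** The three pairs [i < j] below 3 contribute the terms
    [- w [x, y] z + w [x, z] y + w x [y, z]]. *)
Lemma cocycle2 (w : g -> g -> a) (f : {ffun 'I_2 -> g} -> a) :
    (forall x, f x = w (x ord0) (x ord_max)) ->
  bilinear2 w -> leibniz2 w -> f \in cocycle g a 2.
Proof.
move=> fE [wl wr] wL; apply/asboolP; split.
  move=> k x c u v /=; rewrite !fE !ffunE.
  by case: k => [[|[|k]] ltk2] //=; [exact: wl | exact: wr].
apply/funext => x; rewrite /delta !big_ord_recl !big_ord0.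
(* The sums over [j] carry the condition [i < j], which must become a
   conditional summand before they can be unrolled. *)
rewrite !(big_mkcond (fun j : 'I_3 => (_ < j)%N)) !big_ord_recl !big_ord0 /=.
rewrite !fE !ffunE /= -![(-1) ^+ _.+2]signr_odd /=.
have -> : lift (lift ord0 ord0) ord_max = ord_max :> 'I_3 by apply: val_inj.
have -> : lift ord0 (lift ord0 ord0) = ord_max :> 'I_3 by apply: val_inj.
have -> : lift ord_max ord_max = lift ord0 ord0 :> 'I_3 by apply: val_inj.
have -> : lift ord_max ord0 = ord0 :> 'I_3 by apply: val_inj.
rewrite expr1 expr0 scaleN1r !scale1r !add0r !addr0 wL -addrA.
exact: addNr.
Qed.

(** The only pair [i < j] below 2 has [j = 1], hence sign [-1]. *)
Lemma coboundary2 (e : g -> a) (f : {ffun 'I_2 -> g} -> a) :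
    linear e -> (forall x, f x = - e (bracket (x ord0) (x ord_max))) ->
  coboundary f.
Proof.
move=> le fE; exists (fun x : {ffun 'I_1 -> g} => e (x ord0)).
  move=> k x c u v /=; rewrite !ffunE.
  by rewrite (ord1 k) eqxx; exact: le.
apply/funext => x; rewrite fE /delta !big_ord_recl !big_ord0.
rewrite !(big_mkcond (fun j : 'I_2 => (_ < j)%N)) !big_ord_recl !big_ord0 /=.
rewrite !ffunE /= -signr_odd expr1 scaleN1r !add0r !addr0.
by congr (- e (bracket _ (x _))); apply: val_inj.
Qed.

Lemma eq_cohomology_class n (f f' : {ffun 'I_n -> g} -> a)
    (fZ : f \in cocycle g a n) (f'Z : f' \in cocycle g a n) :
  coboundary (f - f') -> cohomology_class fZ = cohomology_class f'Z.
Proof.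
by move=> fB; apply/eqP; rewrite -Quotient.idealrBE; apply/asboolP.
Qed.

(** The natural action of a pair of endomorphisms on bilinear maps. *)
Definition twist (phig : g -> g) (phia : a -> a) (w : g -> g -> a) x y :=
  phia (w x y) - w (phig x) y - w x (phig y).

Lemma twist_bilinear2 (phig : {linear g -> g}) (phia : {linear a -> a}) w :
  bilinear2 w -> bilinear2 (twist phig phia w).
Proof.
move=> [wl wr]; split=> [y|x] c u v /=; rewrite /twist linearP.
  have /= wlE y' := wl y' c.
  by rewrite !wlE linearP !scalerBr !opprD !addrA; rewrite (ACl (1*3*5*2*4*6)).
have /= wrE x' := wr x' c.
by rewrite !wrE linearP !scalerBr !opprD !addrA; rewrite (ACl (1*3*5*2*4*6)).
Qed.

(** Once the derivation rule has split [phig (bracket x y)], both sides are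
    [phia] of the identity for [w] at [x, y, z], minus this identity with [phig]
    applied to one of [x], [y], [z] at a time. *)
Lemma twist_leibniz2 (phig : {linear g -> g}) (phia : {linear a -> a}) w :
    derivation phig -> bilinear2 w -> leibniz2 w ->
  leibniz2 (twist phig phia w).
Proof.
move=> dg [wl wr] wL x y z.
have wDl u v t : w (u + v) t = w u t + w v t.
  by have /= := wl t 1 u v; rewrite !scale1r.
have wDr u v t : w t (u + v) = w t u + w t v.
  by have /= := wr t 1 u v; rewrite !scale1r.
rewrite /twist !dg !wDl !wDr !(wL _ y) !(wL _ (phig y)) linearD /=.
by rewrite !opprD !addrA [LHS](ACl (1*3*7*5*2*4*6*8)).
Qed.

End LowDegree.

(** * The defect of a section *)

Section Defect.
Context {K : fieldType} {a h g : leibnizType K}.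
Context {i : {linear a -> h}} {p : {linear h -> g}}.
Hypothesis Ext : central_extension i p.

Lemma bracket_add_central x y u v :
  bracket (x + i u) (y + i v) = bracket x y.
Proof.
rewrite bracketDl !bracketDr.
by rewrite !(proj1 (ext_central Ext _ _)) !(proj2 (ext_central Ext _ _)) !addr0.
Qed.

(** Exactness gives a preimage under [i] pointwise; injectivity of [i] makes it
    linear.  Applied to the difference of two sections below. *)
Lemma lift_kernel (V : lmodType K) (f : {linear V -> h}) :
  (forall x, p (f x) = 0) -> exists u : {linear V -> a}, forall x, i (u x) = f x.
Proof.
move=> pf0; have [u uE] := choice (fun x => (ext_exact Ext (f x)).1 (pf0 x)).
have lu : linear u.
  by move=> c x y; apply: (ext_inj Ext); rewrite linearP !uE linearP.
pose U := GRing.isLinear.Build K V a *:%R u lu.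
by exists (HB.pack u U : {linear V -> a}).
Qed.

Section OneSection.
Variable s : {linear g -> h}.
Hypothesis ps : is_section p s.

Lemma psi_bilinear2 : bilinear2 (psi i s).
Proof.
split=> [y|x] c u v /=; apply: (ext_inj Ext);
  rewrite linearP /= !(psiE _ _ Ext ps).
  have /= -> := bracket_linearl y c u v.
  rewrite !linearP /=; have /= -> := bracket_linearl (s y) c (s u) (s v).
  by rewrite scalerDr addrACA.
have /= -> := bracket_linearr x c u v.
rewrite !linearP /=; have /= -> := bracket_linearr (s x) c (s u) (s v).
by rewrite scalerDr addrACA.
Qed.

(** The Leibniz identity of [h] at [s x], [s y], [s z], whose [s g]-components
    cancel by the Leibniz identity of [g]. *)
Lemma psi_leibniz2 : leibniz2 (psi i s).
Proof.
move=> x y z; apply: (ext_inj Ext); rewrite linearD /= !(psiE _ _ Ext ps).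
(* Inside a bracket the central term [i (psi s u v)] is invisible, so there
   [s (bracket u v)] may be replaced by [bracket (s u) (s v)]. *)
have sE u v : bracket (s u) (s v) = s (bracket u v) + i (psi i s u v).
  by rewrite (psiE _ _ Ext ps) addrC subrK.
have brl u v w :
    bracket (s (bracket u v)) (s w) = bracket (bracket (s u) (s v)) (s w).
  by rewrite (sE u v) -{2}[s w]addr0 -(raddf0 i) bracket_add_central.
have brr u v w :
    bracket (s u) (s (bracket v w)) = bracket (s u) (bracket (s v) (s w)).
  by rewrite (sE v w) -{2}[s u]addr0 -(raddf0 i) bracket_add_central.
rewrite !brl brr bracket_leibniz (bracket_leibniz x).
by rewrite [s (_ + _)]linearD opprD addrACA.
Qed.

Lemma obstruction_cocycle (phig : {linear g -> g}) (phia : {linear a -> a}) :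
  derivation phig -> obstruction i phig phia s \in cocycle g a 2.
Proof.
move=> dg; apply: (@cocycle2 _ _ _ (twist phig phia (psi i s))) => //.
  exact/twist_bilinear2/psi_bilinear2.
exact: (twist_leibniz2 _ _ _ dg psi_bilinear2 psi_leibniz2).
Qed.

End OneSection.

Lemma psi_section (s s' : {linear g -> h}) (u : g -> a) :
    is_section p s -> is_section p s' -> (forall x, i (u x) = s x - s' x) ->
  forall x y, psi i s x y = psi i s' x y - u (bracket x y).
Proof.
move=> ps ps' uE x y; apply: (ext_inj Ext).
have sE z : s z = s' z + i (u z) by rewrite uE addrC subrK.
by rewrite linearB /= (psiE _ _ Ext ps) (psiE _ _ Ext ps') !sE bracket_add_central opprD addrA.
Qed.

Lemma obstruction_section (phig : {linear g -> g}) (phia : {linear a -> a})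
    (s s' : {linear g -> h}) :
    derivation phig -> is_section p s -> is_section p s' ->
  coboundary (obstruction i phig phia s - obstruction i phig phia s').
Proof.
move=> dg ps ps'.
have [|u uE] := lift_kernel _ (s \- s').
  by move=> x; rewrite /= linearB /= ps ps' subrr.
have psiD := psi_section _ _ _ ps ps' uE.
apply: (@coboundary2 _ _ _ ((phia \o u) \- (u \o phig))) => [|x].
  exact: linearP.
rewrite !fctE /obstruction /= !psiD dg !linearB linearD /=.
(* The defect of [s'] enters both obstructions in the same three terms, which
   cancel pairwise; what remains is the contribution of [u]. *)
rewrite !opprK !addrA [LHS](ACl (2*4*6*(1*7)*(3*8)*(5*9))) /=.
by rewrite subrr !addNr !addr0.
Qed.

End Defect.

Theorem proposition4p5 (K : fieldType) (charK0 : [pchar K] =i pred0)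
    (a h g : leibnizType K) (i : {linear a -> h}) (p : {linear h -> g})
    (Ext : central_extension i p)
    (phig : {linear g -> g}) (phia : {linear a -> a})
    (phig_der : derivation phig) (phia_der : derivation phia) :
  (forall s : {linear g -> h}, is_section p s ->
     obstruction i phig phia s \in cocycle g a 2) /\
  (forall s s' : {linear g -> h}, is_section p s -> is_section p s' ->
     forall (Z1 : obstruction i phig phia s \in cocycle g a 2)
            (Z2 : obstruction i phig phia s' \in cocycle g a 2),
       cohomology_class Z1 = cohomology_class Z2 :> H g a 2).
Proof.
split=> [s ps|s s' ps ps' Z1 Z2]; first exact: (obstruction_cocycle Ext _ ps).
exact/eq_cohomology_class/(obstruction_section Ext).
Qed.
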